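(* Let $G=(V,E)$ be a graph with $|V|\geq 3$ which is an $n$-convex geometry without stars, and let $x\in V$ be a quasi-star of $G$, that is, $d(x)=|V|-2$. Let $v(x)$ be the unique vertex in $V\setminus N[x]$. Then the vertex-deleted subgraph $G-\{x,v(x)\}$ (the subgraph of $G$ induced by $V\setminus\{x,v(x)\}$) is an $n$-convex geometry without stars.
   Context: All graphs are finite, simple and undirected, with non-empty vertex set. $d(x)$ denotes the degree of the vertex $x$. For a graph $G=(V,E)$ and $x\in V$, the closed neighbourhood of $x$ is $N[x]=\{x\}\cup\{y\in V:\{x,y\}\in E\}$. A star of $G$ is a vertex $s$ with $N[s]=V$. For $Y\subseteq V$, the common closed neighbourhood is $N[Y]=\bigcap_{y\in Y}N[y]$ if $Y\neq\varnothing$, and $N[\varnothing]=V$. The neighbourhood convexity of $G$ is the family $n_G=\{N[Y]:Y\subseteq V\}\cup\{\varnothing\}$ of subsets of $V$; it contains $\varnothing$ and $V$ and is closed under intersection. Its members are called $n$-convex sets. For $X\subseteq V$ the convex hull $[X]_{n}$ is the intersection of all $n$-convex sets containing $X$. For an $n$-convex set $K$, $\operatorname{ex}(K)=\{x\in K: K\setminus\{x\}\in n_G\}$ is the set of extreme points of $K$. $G$ is an $n$-convex geometry if $K=[\operatorname{ex}(K)]_{n}$ for every $n$-convex set $K$. A subgraph is an $n$-convex geometry if it is so with respect to its own neighbourhood convexity. *)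

(* Defs.v *)
From mathcomp Require Import all_boot.

Set Implicit Arguments.
Unset Strict Implicit.
Unset Printing Implicit Defensive.

(* The empty graph is not excluded here; a non-empty vertex set is to be
   imposed where it matters through a bound on #|G|. *)
Record sgraph := SGraph {
  svertex :> finType;
  adj : rel svertex;
  adj_sym : symmetric adj;
  adj_irrefl : irreflexive adj }.

Section InducedSubgraph.
Variables (G : sgraph) (S : {set G}).

Let vertices : finType := {u : G | u \in S}.
Let edges : rel vertices := fun u w => adj (val u) (val w).

Fact induced_sym : symmetric edges.
Proof. by move=> u w; apply: adj_sym. Qed.

Fact induced_irrefl : irreflexive edges.
Proof. by move=> u; apply: adj_irrefl. Qed.

Definition induced : sgraph := SGraph induced_sym induced_irrefl.
End InducedSubgraph.

Definition delete_vertices (G : sgraph) (S : {set G}) : sgraph :=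
  induced (~: S).

Section NeighbourhoodConvexity.
Variable G : sgraph.
Implicit Types (x : G) (X Y K : {set G}).

Definition degree x : nat := #|[set y | adj x y]|.

Definition closed_nbh x : {set G} := x |: [set y | adj x y].

Definition star x : Prop := closed_nbh x = [set: G].

(* d(x) = |V| - 2, written additively to avoid truncated subtraction. *)
Definition quasi_star x : Prop := degree x + 2 = #|G|.

(* For Y = set0 the intersection is [set: G]. *)
Definition common_nbh Y : {set G} := \bigcap_(y in Y) closed_nbh y.

Definition n_convexity : {set {set G}} :=
  [set common_nbh Y | Y : {set G}] :|: [set set0].

Definition n_hull X : {set G} :=
  \bigcap_(K in n_convexity | X \subset K) K.

Definition extreme K : {set G} := [set x in K | K :\ x \in n_convexity].

Lemma quasi_star_unique x :
  quasi_star x -> exists! v, v \in ~: closed_nbh x.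
Proof.
move=> hx; have /eqP/cards1P[v ->] : #|~: closed_nbh x| = 1.
  apply/eqP; rewrite -(eqn_add2l #|closed_nbh x|) cardsC -hx.
  by rewrite cardsU1 inE adj_irrefl -/(degree x) addn1 addn2.
by exists v; split=> [|w]; rewrite inE // => /eqP.
Qed.

End NeighbourhoodConvexity.

Definition n_convex_geometry (G : sgraph) : Prop :=
  forall K : {set G}, K \in n_convexity G -> K = n_hull (extreme K).

Definition without_stars (G : sgraph) : Prop := forall s : G, ~ star s.

(* Main.v *)
(** A copoint attached to [z] is a maximal convex set avoiding [z]. In a convex
    geometry without stars every copoint is some [N[y]] and is attached to a
    single vertex, and every vertex has a copoint. Counting then yields a
    permutation [tau] such that [N[tau z]] is the only copoint attached to [z],
    so that [w] is outside [N[tau z]] iff [N[w]] is contained in [N[z]]. Hence,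
    for the partial order [z <= w] given by the latter inclusion, every [N[y]]
    is the complement of a principal up-set, and the convex sets are the
    down-sets. For a quasi-star [x], [tau] exchanges [x] and [v(x)], so this
    description is inherited by the order induced on the other vertices.
    Conversely, the down-sets of a finite poset form a convex geometry, whose
    extreme points are the maximal elements. *)

Require Import Defs.
From mathcomp Require Import all_boot.

Set Implicit Arguments.
Unset Strict Implicit.
Unset Printing Implicit Defensive.

Section ClosedNeighbourhoods.
Variable G : sgraph.
Implicit Types (x y z w : G) (X Y K L : {set G}).

Lemma closed_nbhE x y : (y \in closed_nbh x) = (y == x) || adj x y.
Proof. by rewrite !inE. Qed.

Lemma closed_nbh_sym x y : (y \in closed_nbh x) = (x \in closed_nbh y).
Proof. by rewrite !closed_nbhE eq_sym adj_sym. Qed.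

Lemma closed_nbh_refl x : x \in closed_nbh x.
Proof. by rewrite closed_nbhE eqxx. Qed.

Lemma common_nbhP w Y :
  reflect (forall y, y \in Y -> w \in closed_nbh y) (w \in common_nbh Y).
Proof. exact: bigcapP. Qed.

Lemma common_nbh_convex Y : common_nbh Y \in n_convexity G.
Proof. by rewrite inE imset_f. Qed.

Lemma closed_nbh_convex y : closed_nbh y \in n_convexity G.
Proof.
have -> : closed_nbh y = common_nbh [set y] by rewrite /common_nbh big_set1.
exact: common_nbh_convex.
Qed.

Lemma n_convexP K :
  reflect ((exists Y, K = common_nbh Y) \/ K = set0) (K \in n_convexity G).
Proof.
rewrite !inE; apply: (iffP orP).
  by case=> [/imsetP[Y _ ->]|/eqP->]; [left; exists Y | right].
by case=> [[Y ->]|->]; [left; rewrite imset_f | right].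
Qed.

Lemma n_hullP w X :
  reflect (forall K, K \in n_convexity G -> X \subset K -> w \in K)
          (w \in n_hull X).
Proof.
apply: (iffP bigcapP) => [h K cK sXK|h K /andP[]]; last exact: h.
by apply: h; rewrite cK.
Qed.

End ClosedNeighbourhoods.

(** * Convex geometry of the down-sets of a finite order *)

Section DownSets.
Variables (G : sgraph) (le : rel G).
Hypothesis le_refl : reflexive le.
Hypothesis le_trans : transitive le.
Hypothesis le_anti : antisymmetric le.
Hypothesis nbh_upset :
  forall y, exists z, forall w, (w \in closed_nbh y) = ~~ le z w.
Hypothesis upset_nbh :
  forall z, exists y, forall w, (w \in closed_nbh y) = ~~ le z w.
Implicit Types (w z : G) (K : {set G}).

Lemma upset_nbh_without_stars : without_stars G.
Proof.
move=> s ss; have [z hz] := nbh_upset s.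
by have := hz z; rewrite ss in_setT le_refl.
Qed.

(** Complements of up-sets are down-sets, and so are their intersections. Conversely a down-set [K]
    is the intersection of the closed neighbourhoods containing it: for [w] outside [K], the
    complement of the up-set of [w] is one of them and misses [w]. *)
Lemma n_convex_downP K :
  K \in n_convexity G <-> (forall w z, le z w -> w \in K -> z \in K).
Proof.
split=> [/n_convexP[[Y ->]|->] w z lzw|downK]; last 2 first.
- by rewrite inE.
- suff -> : K = common_nbh [set y | K \subset closed_nbh y].
    exact: common_nbh_convex.
  apply/setP=> w; apply/idP/common_nbhP => [wK y|hw].
    by rewrite inE => /subsetP; apply.
  apply/negPn/negP=> wNK; have [y hy] := upset_nbh w.
  have /hw : y \in [set y | K \subset closed_nbh y].
    rewrite inE; apply/subsetP=> u uK; rewrite hy.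
    by apply: contra wNK => /downK; apply.
  by rewrite hy le_refl.
move=> /common_nbhP hw; apply/common_nbhP=> y /hw.
have [u hu] := nbh_upset y; rewrite !hu.
by apply: contra => /le_trans; apply.
Qed.

Lemma maximal_above K w : w \in K ->
  exists m, [/\ m \in K, le w m & forall u, u \in K -> le m u -> u = m].
Proof.
move=> wK; pose P m := (m \in K) && le w m.
have Pw : P w by rewrite /P wK le_refl.
(* With the largest principal down-set chosen, anything in [K] above [m] has the same one, and
   antisymmetry makes it [m]. *)
case: (arg_maxnP (fun m => #|[set u | le u m]|) Pw) => m /andP[mK lwm] maxm.
exists m; split=> // u uK lmu.
have sub : [set t | le t m] \subset [set t | le t u].
  by apply/subsetP=> t; rewrite !inE => /le_trans; apply.
have /eqP eqd : [set t | le t m] == [set t | le t u].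
  by rewrite eqEcard sub; apply: maxm; rewrite /P uK (le_trans lwm lmu).
apply: le_anti; rewrite lmu andbT.
by have := le_refl u; rewrite -[le u u](in_set (le^~ u)) -eqd inE.
Qed.

Lemma upset_nbh_convex_geometry : n_convex_geometry G.
Proof.
move=> K cK; have downK := (n_convex_downP K).1 cK.
apply/eqP; rewrite eqEsubset; apply/andP; split; apply/subsetP=> w; last first.
  move/n_hullP; apply=> //.
  by apply/subsetP=> u; rewrite inE => /andP[].
move=> wK; apply/n_hullP=> L /n_convex_downP downL /subsetP exL.
have [m [mK lwm maxm]] := maximal_above wK.
(* [m] is extreme, since a down-set deprived of a maximal element is still a down-set. *)
apply: (downL m _ lwm); apply: exL; rewrite inE mK /=.
apply/n_convex_downP=> u z lzu; rewrite !inE => /andP[um uK].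
rewrite (downK _ _ lzu uK) andbT.
by apply: contraNneq um => zm; rewrite (maxm u) // -zm.
Qed.

End DownSets.

(** * Copoints and the permutation they induce *)

Section Copoints.
Variable G : sgraph.
Hypothesis geomG : n_convex_geometry G.
Hypothesis nostarG : without_stars G.
Implicit Types (x y z w u : G) (K L : {set G}).

(** Maximality is tested against closed neighbourhoods only; [copoint_max] extends it to all convex
    sets. *)
Definition copoint y z :=
  z \notin closed_nbh y /\
  forall y', closed_nbh y \subset closed_nbh y' -> z \notin closed_nbh y' ->
    closed_nbh y' \subset closed_nbh y.

Lemma copoint_max y z L : copoint y z -> L \in n_convexity G ->
  closed_nbh y \subset L -> z \notin L -> L = closed_nbh y.
Proof.
move=> [_ maxy] cL syL zL; apply/eqP; rewrite eqEsubset syL andbT.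
case/n_convexP: cL => [[Y defL]|->]; last exact: sub0set.
have [y' y'Y zy'] : exists2 y', y' \in Y & z \notin closed_nbh y'.
  apply/exists_inP; apply: contraR zL => /exists_inPn h; rewrite defL.
  by apply/common_nbhP=> y' /h /negPn.
have sLy' : L \subset closed_nbh y' by rewrite defL bigcap_inf.
by apply: subset_trans sLy' (maxy _ (subset_trans syL sLy') zy').
Qed.

(* The convex sets strictly above [N[y]] are those containing [N[y]] and [z].
   The least of them has an extreme point outside [N[y]], so it exceeds [N[y]]
   by one vertex only. *)
Lemma copoint_inj y z z' : copoint y z -> copoint y z' -> z = z'.
Proof.
move=> cz cz'; have [zy _] := cz; have [z'y _] := cz'.
(* By symmetry of adjacency, applying [common_nbh] twice is a Galois closure; on this non-empty set
   it gives the convex hull. *)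
have hull_convex : common_nbh (common_nbh (z |: closed_nbh y)) \in n_convexity G.
  exact: common_nbh_convex.
set K := common_nbh _ in hull_convex.
have sK : z |: closed_nbh y \subset K.
  apply/subsetP=> w wX; apply/common_nbhP=> t /common_nbhP ht.
  by rewrite closed_nbh_sym ht.
have zK : z \in K by rewrite (subsetP sK) // setU11.
have syK : closed_nbh y \subset K by apply: subset_trans sK; apply: subsetUr.
have z'K : z' \in K.
  apply: contraR zy => z'K.
  by rewrite -(copoint_max cz' hull_convex syK z'K).
have least L : L \in n_convexity G -> z |: closed_nbh y \subset L -> K \subset L.
  case/n_convexP=> [[Y ->]|->] sL; last first.
    by have := subsetP sL z (setU11 _ _); rewrite inE.
  apply/subsetP=> w /common_nbhP hw; apply/common_nbhP=> t tY; apply: hw.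
  apply/common_nbhP=> s /(subsetP sL)/common_nbhP/(_ t tY).
  by rewrite closed_nbh_sym.
have [e eK eNy] : exists2 e, e \in extreme K & e \notin closed_nbh y.
  apply/exists_inP; apply: contraR zy => /exists_inPn h.
  have : z \in n_hull (extreme K) by rewrite -geomG.
  move/n_hullP; apply; first exact: closed_nbh_convex.
  by apply/subsetP=> u /h /negPn.
move: eK; rewrite inE => /andP[eK cKe].
have sKe : closed_nbh y \subset K :\ e.
  by apply/subsetD1P; split.
have zNKe : z \notin K :\ e.
  apply/negP=> zKe; have := subsetP (least _ cKe _) e eK.
  by rewrite subUset sub1set zKe sKe !inE eqxx => /(_ isT).
have eqKe := copoint_max cz cKe sKe zNKe.
have one t : t \in K -> t \notin closed_nbh y -> t = e.
  by move=> tK; rewrite -eqKe !inE tK andbT negbK => /eqP.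
by rewrite (one z) // (one z').
Qed.

Lemma copoint_above u z : z \notin closed_nbh u ->
  exists2 y, closed_nbh u \subset closed_nbh y & copoint y z.
Proof.
move=> zu.
pose P y := (closed_nbh u \subset closed_nbh y) && (z \notin closed_nbh y).
have Pu : P u by rewrite /P subxx zu.
case: (arg_maxnP (fun y => #|closed_nbh y|) Pu) => y /andP[suy zy] maxy.
exists y => //; split=> // y' syy' zy'.
have : closed_nbh y == closed_nbh y'.
  by rewrite eqEcard syy'; apply: maxy; rewrite /P zy' (subset_trans suy syy').
by move/eqP->.
Qed.

Lemma copoint_exists z : exists y, copoint y z.
Proof.
(* A vertex lying in every closed neighbourhood would be a star. *)
have [u zu] : exists u, z \notin closed_nbh u.
  apply/existsP; apply: contraT => /existsPn h; case: (nostarG (s := z)).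
  by apply/setP=> u; rewrite in_setT closed_nbh_sym; apply/negPn/h.
by have [y _ cy] := copoint_above zu; exists y.
Qed.

(** A choice of copoints is injective, as no copoint is attached to two vertices, hence bijective by
    finiteness. *)
Lemma copoint_perm : exists2 tau : G -> G,
  bijective tau & forall z, copoint (tau z) z.
Proof.
have [tau ctau] := fin_all_exists copoint_exists.
exists tau => //; apply: injF_bij => z z' eqt.
by apply: (@copoint_inj (tau z)); rewrite // eqt.
Qed.

Lemma upset_perm : exists2 tau : G -> G, bijective tau &
  forall z w, (w \in closed_nbh (tau z)) =
              ~~ (closed_nbh w \subset closed_nbh z).
Proof.
have [tau bij_tau ctau] := copoint_perm; exists tau => // z w.
have [tau' _ tauK] := bij_tau.
apply/idP/idP => [wt|].
  apply/negP=> /subsetP/(_ (tau z)); rewrite -closed_nbh_sym => /(_ wt).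
  by rewrite closed_nbh_sym; apply/negP; case: (ctau z).
apply: contraR => wNt; apply/subsetP=> u; rewrite closed_nbh_sym => wu.
rewrite closed_nbh_sym; apply: contraR wNt => zu.
(* Every vertex is a value of [tau], so a copoint attached to [z] can only come from [tau z]. *)
have [y suy cy] := copoint_above zu.
have eqz : z = tau' y by apply: (@copoint_inj y); rewrite // -{1}[y]tauK.
by rewrite eqz tauK (subsetP suy).
Qed.

(** Being a copoint depends on [y] only through its neighbourhood, so equal neighbourhoods are
    attached to the same vertex. This gives antisymmetry of the order. *)
Lemma closed_nbh_inj : injective (@closed_nbh G).
Proof.
have [tau [tau' _ tauK] ctau] := copoint_perm.
move=> a b eqN; rewrite -[a]tauK -[b]tauK; congr tau.
apply: (@copoint_inj a); first by rewrite -{1}[a]tauK.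
by have := ctau (tau' b); rewrite tauK /copoint eqN.
Qed.

(** The vertex [tau' x] is outside the neighbourhood of [x], so it is [v]. As [x] and [v] are not
    adjacent, the neighbourhood of [tau' v] contains that of [x], which misses [v] alone; [tau' v]
    not being a star, the two agree. *)
Lemma quasi_star_perm x v (tau : G -> G) : bijective tau ->
    (forall z w, (w \in closed_nbh (tau z)) =
                 ~~ (closed_nbh w \subset closed_nbh z)) ->
    quasi_star x -> v \in ~: closed_nbh x ->
  tau v = x /\ tau x = v.
Proof.
move=> [tau' tau'K tauK] htau /quasi_star_unique[v0 [_ uniq_v]] hv.
have eqv w : w \notin closed_nbh x -> w = v.
  by rewrite -in_setC => wx; rewrite -(uniq_v _ wx) (uniq_v _ hv).
split.
  suff -> : v = tau' x by rewrite tauK.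
  by apply/esym/eqv; rewrite -{2}[x]tauK htau negbK.
suff -> : x = tau' v by rewrite tauK.
apply: closed_nbh_inj.
have sub : closed_nbh x \subset closed_nbh (tau' v).
  by rewrite -[_ \subset _]negbK -htau tauK closed_nbh_sym -in_setC.
apply/eqP; rewrite eqEsubset sub /=; apply/subsetP=> w wN.
apply: contraT => /eqv eqw; case: (nostarG (s := tau' v)).
apply/setP=> t; rewrite in_setT.
have [/(subsetP sub)//|/eqv ->] := boolP (t \in closed_nbh x).
by rewrite -{1}eqw.
Qed.

End Copoints.

(** * Passage to the vertex-deleted subgraph *)

Lemma induced_closed_nbh (G : sgraph) (S : {set G}) (u w : induced S) :
  (w \in closed_nbh u) = (val w \in closed_nbh (val u)).
Proof. by rewrite !closed_nbhE. Qed.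

Lemma induced_vertexP (G : sgraph) (S : {set G}) (u : G) :
  u \in S -> exists w : induced S, val w = u.
Proof. by move=> uS; exists (exist (fun t => t \in S) u uS). Qed.

Theorem theorem33 (G : sgraph) (x v : G)
    (hcard : 3 <= #|G|)
    (hgeom : n_convex_geometry G)
    (hstar : without_stars G)
    (hx : quasi_star x)
    (hv : v \in ~: closed_nbh x) :
  n_convex_geometry (delete_vertices [set x; v]) /\
  without_stars (delete_vertices [set x; v]).
Proof.
have [tau bij_tau htau] := upset_perm hgeom hstar.
have [tauv taux] := quasi_star_perm hgeom hstar bij_tau htau hx hv.
have tau_inj := bij_inj bij_tau; have [tau' _ tauK] := bij_tau.
(* Since [tau] exchanges [x] and [v], it permutes the remaining vertices. *)
have tauS z : (tau z \in ~: [set x; v]) = (z \in ~: [set x; v]).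
  by rewrite !inE -(inj_eq tau_inj z x) -(inj_eq tau_inj z v) taux tauv orbC.
pose H := delete_vertices [set x; v].
(* The order compares neighbourhoods taken in [G], not in [H]. *)
pose le : rel H := fun z w => closed_nbh (val w) \subset closed_nbh (val z).
have le_refl : reflexive le by move=> z; apply: subxx.
have le_trans : transitive le.
  by move=> b a c lab lbc; apply: subset_trans lbc lab.
have le_anti : antisymmetric le.
  move=> a b /andP[lab lba]; apply/val_inj/(closed_nbh_inj hgeom hstar).
  by apply/eqP; rewrite eqEsubset; apply/andP; split.
have nbh_upset (y : H) :
    exists z : H, forall w, (w \in closed_nbh y) = ~~ le z w.
  have zS : tau' (val y) \in ~: [set x; v] by rewrite -tauS tauK (valP y).
  have [z def_z] := induced_vertexP zS; exists z => w.
  by rewrite induced_closed_nbh /le def_z -htau tauK.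
have upset_nbh (z : H) :
    exists y : H, forall w, (w \in closed_nbh y) = ~~ le z w.
  have yS : tau (val z) \in ~: [set x; v] by rewrite tauS (valP z).
  have [y def_y] := induced_vertexP yS; exists y => w.
  by rewrite induced_closed_nbh def_y htau.
split; last exact: upset_nbh_without_stars nbh_upset.
exact: upset_nbh_convex_geometry nbh_upset upset_nbh.
Qed.
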